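(* Let $m\geq 1$ be a fixed integer. For every $0<\beta<1/2$, $$\gamma_{m,n}\left\{P\in\mathcal{P}_m(\mathbb{R}^n): V(P)\geq (1-n^{-\beta})M(P)\right\}\longrightarrow 1\qquad (n\to\infty).$$ In fact, if for each $n$ the random polynomial $P_n$ is chosen according to $\gamma_{m,n}$, then $$n^\beta\left(1-\frac{V(P_n)}{M(P_n)}\right)\longrightarrow 0$$ in probability as $n\to\infty$. In particular, $\dfrac{V(P_n)}{M(P_n)}\to 1$ in probability.
   Context: $\mathcal{P}_m(\mathbb{R}^n)$ is the real vector space of polynomials $P:\mathbb{R}^n\to\mathbb{R}$ that are $m$-homogeneous, i.e. $P(x)=\sum_{\alpha\in\mathbb{N}_0^n,\,|\alpha|=m}a_\alpha x^\alpha$, where $|\alpha|=\alpha_1+\cdots+\alpha_n$ and $x^\alpha=x_1^{\alpha_1}\cdots x_n^{\alpha_n}$. For such $P$, $M(P)=\max_{x\in[-1,1]^n}|P(x)|$ and $V(P)=\max_{\varepsilon\in\{-1,1\}^n}|P(\varepsilon)|$. The Bombieri norm is $\|P\|_B^2=\sum_{|\alpha|=m}a_\alpha^2\,\frac{\alpha!}{m!}$ with $\alpha!=\alpha_1!\cdots\alpha_n!$. The measure $\gamma_{m,n}$ is the standard Gaussian measure of the Hilbert space $(\mathcal{P}_m(\mathbb{R}^n),\|\cdot\|_B)$; that is, it is the law of $$P_n(x)=\sum_{|\alpha|=m}\sqrt{\tbinom{m}{\alpha}}\,g_\alpha x^\alpha,\qquad \tbinom{m}{\alpha}=\frac{m!}{\alpha_1!\cdots\alpha_n!},$$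 where $(g_\alpha)_{|\alpha|=m}$ are independent standard real Gaussian random variables. The ratio $V(P_n)/M(P_n)$ is defined whenever $P_n\neq 0$, which holds with probability one. *)

(* Defs.v *)
From HB Require Import structures.
From mathcomp Require Import all_boot all_order all_algebra.
From mathcomp Require mpoly.
From mathcomp Require Import all_classical all_reals all_analysis.
From mathcomp Require Import measurable_realfun.
(* The notations of mpoly and of mathcomp-analysis cannot be loaded together. *)
Import -(notations) mpoly.
Import Order.TTheory GRing.Theory Num.Theory.
Import numFieldNormedType.Exports.

Set Implicit Arguments.
Unset Strict Implicit.
Unset Printing Implicit Defensive.

Local Open Scope classical_set_scope.
Local Open Scope ring_scope.

(* The space of m-homogeneous polynomials is mpoly's [dhomog n R m].  Its
   sigma-algebra is generated by the coefficient maps; this is the Borel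
   sigma-algebra of the finite-dimensional space. *)
Section dhomog_measurable.
Context (n : nat) (R : realType) (m : nat).

HB.instance Definition _ := isPointed.Build (dhomog n R m) 0.

Definition dhomog_coef (a : multinom n) (P : dhomog n R m) : measurableTypeR R :=
  mcoeff a (val P).

Definition dhomog_measurable : set (set (dhomog n R m)) :=
  <<s \bigcup_(a in [set: multinom n])
        preimage_set_system setT (dhomog_coef a) measurable >>.

Let dhomog_measurable0 : dhomog_measurable set0.
Proof. exact: sigma_algebra0. Qed.

Let dhomog_measurableC A : dhomog_measurable A -> dhomog_measurable (~` A).
Proof. exact: sigma_algebraC. Qed.

Let dhomog_measurable_bigcup (F : (set (dhomog n R m))^nat) :
  (forall i, dhomog_measurable (F i)) -> dhomog_measurable (\bigcup_i (F i)).
Proof. exact: sigma_algebra_bigcup. Qed.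

HB.instance Definition _ := @isMeasurable.Build default_measure_display
  (dhomog n R m) dhomog_measurable
  dhomog_measurable0 dhomog_measurableC dhomog_measurable_bigcup.

End dhomog_measurable.

Section norms.
Context (R : realType) (n m : nat).
Implicit Type P : dhomog n R m.

(* The supremum is a maximum: |P| is continuous and the cube is compact. *)
Definition cube_max P : R :=
  sup [set `|meval x (val P)| | x in
        [set x : 'I_n -> R | forall i, -1 <= x i <= 1]].

(* [e] encodes the vertex with coordinates (-1) ^ (e i). *)
Definition vertex_max P : R :=
  \big[Num.max/0]_(e : {ffun 'I_n -> bool})
    `|meval (fun i => (-1) ^+ e i) (val P)|.

End norms.

Section gaussian_tuple.
Context (R : realType).
Local Notation RR := (measurableTypeR R).

Definition tuple_cons k (xt : RR * k.-tuple RR) : k.+1.-tuple RR :=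
  [tuple of xt.1 :: xt.2].

Let measurable_tuple_cons k : measurable_fun setT (@tuple_cons k).
Proof. exact: measurable_cons. Qed.

HB.instance Definition _ k := isMeasurableFun.Build _ _ _ _ (@tuple_cons k)
  (@measurable_tuple_cons k).

(* The product of k copies of N(0,1). *)
Fixpoint gaussian_tuple k : probability (k.-tuple RR) R :=
  if k is k'.+1 then
    distribution (normal_prob (0 : R) 1 \x gaussian_tuple k')%E (@tuple_cons k')
  else \d_ [tuple].

End gaussian_tuple.

Section gaussian_polynomial.
Context (R : realType) (n m : nat).

Definition multiindex := {a : bmultinom n m.+1 | mdeg a == m}.

Definition multiindex_mnm (a : multiindex) : multinom n := val (val a).

Definition multinomial_coef (a : multiindex) : R :=
  m`!%:R / \prod_(i < n) ((multiindex_mnm a i)`!)%:R.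

Lemma multiindex_homog (a : multiindex) :
  mpolyX R (multiindex_mnm a) \is ishomog1 m (@mdeg n).
Proof. by rewrite dhomogX /=; exact: (valP a). Qed.

Definition dhomog_mnm (a : multiindex) : dhomog n R m :=
  DHomog (multiindex_homog a).

Definition gaussian_poly (g : #|{: multiindex}|.-tuple (measurableTypeR R)) :
    dhomog n R m :=
  \sum_(a : multiindex)
    (Num.sqrt (multinomial_coef a) * tnth g (enum_rank a)) *: dhomog_mnm a.

Let measurable_gaussian_poly : measurable_fun setT gaussian_poly.
Proof.
have mcoef a : measurable_fun setT (dhomog_coef a \o gaussian_poly).
  rewrite (_ : _ \o _ = fun g => \sum_(b : multiindex)
      Num.sqrt (multinomial_coef b) * tnth g (enum_rank b) *
      dhomog_coef a (dhomog_mnm b)); last first.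
    apply/funext => g /=; rewrite /dhomog_coef /gaussian_poly !raddf_sum /=.
    by apply: eq_bigr => b _; rewrite mcoeffZ.
  apply: measurable_sum => b; apply: measurable_funM => //.
  by apply: measurable_funM => //; exact: measurable_tnth.
apply: (@measurability _ _ _ _ _ _ (\bigcup_(a in [set: multinom n])
  preimage_set_system setT (@dhomog_coef n R m a) measurable)) => //.
move=> _ [_ [a _ [A mA <-]] <-]; rewrite !setTI -comp_preimage.
rewrite -[X in measurable X]setTI.
exact: mcoef.
Qed.

HB.instance Definition _ :=
  isMeasurableFun.Build _ _ _ _ gaussian_poly measurable_gaussian_poly.

(* The law of the random polynomial with i.i.d. N(0,1) coordinates g_alpha in
   the basis sqrt(multinomial alpha) x^alpha, which is orthonormal for the
   Bombieri norm. *)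
Definition bombieri_gaussian : probability (dhomog n R m) R :=
  distribution (gaussian_tuple R #|{: multiindex}|) gaussian_poly.

End gaussian_polynomial.

(* The variables need not live on a common probability space. *)
Definition cvg_in_probability (R : realType) (d : nat -> measure_display)
    (T : forall n, measurableType (d n)) (Pr : forall n, probability (T n) R)
    (X : forall n, T n -> R) (l : R) : Prop :=
  forall eps : R, 0 < eps ->
    Pr n [set w | eps < `|X n w - l|] @[n --> \oo] --> 0%E.

(* Main.v *)
Require Import Defs.
From HB Require Import structures.
From mathcomp Require Import all_boot all_order all_algebra.
From mathcomp Require mpoly.
From mathcomp Require Import all_classical all_reals all_analysis.
From mathcomp Require Import measurable_realfun.
From mathcomp Require Import ring lra.
Import -(notations) mpoly.
Import Order.TTheory GRing.Theory Num.Theory.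
Import numFieldNormedType.Exports.

Set Implicit Arguments.
Unset Strict Implicit.
Unset Printing Implicit Defensive.

Local Open Scope classical_set_scope.
Local Open Scope ring_scope.

(* Split P = Q + S, where Q collects the multilinear monomials and S those with
   some exponent at least 2.  A multilinear polynomial takes its maximum over
   the cube at a vertex, so M(P) <= V(P) + 2 M(S).  Giving every factor of a
   monomial its own variable makes S multilinear in nm variables; a union bound
   over the 2^(nm) vertices, with variance at most m! n^(m-1), shows
   M(S) = O(n^(m/2)) with high probability.

   For a lower bound on M(P), split the variables into m blocks by residue mod
   m.  Averaging P over independent sign changes of the blocks isolates the
   monomials with one variable in each block; maximizing over the signs of the
   last block gives M(P) >= \sum_v |D_v|, where the D_v are uncorrelated
   Gaussians of variance at least (n/m)^(m-1).  As D_v has the size of its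
   standard deviation for most v, M(P) is of order n^((m+1)/2), up to a factor
   tending to infinity arbitrarily slowly; hence M(S) / M(P) = o(n^-beta).

   All probabilistic estimates rest on the single identity
   E exp(l(g)) = exp(|l|^2 / 2) for linear forms l: for instance
   E cosh(l) cosh(l') comes from the sum and the difference of l and l', so
   Chebyshev's inequality for \sum_v cosh(D_v) needs no independence. *)

(** * Multilinear polynomials and multi-indices *)

Section multilinear.
Context (R : realType) (I K : finType).

(** The weights are the law of independent signs with means [x i]; the mean of a product of distinct
    signs is the product of their means. *)
Lemma convex_comb_vertices (x : I -> R) (S : {set I}) :
  \prod_(i in S) x i = \sum_(e : {ffun I -> bool})
    (\prod_i ((1 + (-1) ^+ e i * x i) / 2)) * \prod_(i in S) (-1) ^+ e i.
Proof.
pose F i (b : bool) :=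
  (1 + (-1) ^+ b * x i) / 2 * (if i \in S then (-1) ^+ b else 1).
transitivity (\sum_(e : {ffun I -> bool}) \prod_i F i (e i)); last first.
  apply: eq_bigr => e _; rewrite big_split /=; congr (_ * _).
  by rewrite [RHS]big_mkcond.
rewrite -(bigA_distr_bigA F) big_mkcond; apply: eq_bigr => i _.
by rewrite big_bool /F /=; case: ifP => _; rewrite ?expr1 ?expr0; field.
Qed.

(** With the weights above, the value at [x] is a convex combination of the values at the
    vertices. *)
Lemma multilinear_bound (b : K -> R) (S : K -> {set I}) (U : R) (x : I -> R) :
  (forall i, `|x i| <= 1) ->
  (forall e : {ffun I -> bool},
    `|\sum_k b k * \prod_(i in S k) (-1) ^+ e i| <= U) ->
  `|\sum_k b k * \prod_(i in S k) x i| <= U.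
Proof.
move=> x1 hU.
pose p (e : {ffun I -> bool}) := \prod_i ((1 + (-1) ^+ e i * x i) / 2).
have p0 e : 0 <= p e.
  apply: prodr_ge0 => i _; apply: divr_ge0 => //.
  by have := x1 i; rewrite ler_norml => /andP[? ?]; case: (e i); rewrite /=; lra.
have p1 : \sum_e p e = 1.
  have := convex_comb_vertices x finset.set0; rewrite big_set0 => ->.
  by apply: eq_bigr => e _; rewrite big_set0 mulr1.
have -> : \sum_k b k * \prod_(i in S k) x i =
    \sum_e p e * \sum_k b k * \prod_(i in S k) (-1) ^+ e i.
  under eq_bigr do rewrite convex_comb_vertices mulr_sumr.
  rewrite exchange_big; apply: eq_bigr => e _; rewrite mulr_sumr.
  by apply: eq_bigr => k _; rewrite mulrCA.
rewrite (le_trans (ler_norm_sum _ _ _))// -[U]mul1r -[X in _ <= X * _]p1 mulr_suml.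
by apply: ler_sum => e _; rewrite normrM ger0_norm// ler_wpM2l.
Qed.

End multilinear.

Section monomials.
Context (R : realType) (n m : nat).
Local Notation mi := (multiindex n m).
Implicit Types (a : mi) (x : 'I_n -> R).

Definition deg a (i : 'I_n) : nat := multiindex_mnm a i.

Definition mon a x : R := \prod_(i < n) x i ^+ deg a i.

Lemma sum_deg a : (\sum_(i < n) deg a i = m)%N.
Proof. by rewrite -mdegE; apply/eqP; exact: (valP a). Qed.

Lemma deg_le a i : (deg a i <= m)%N.
Proof. by rewrite -[X in (_ <= X)%N](sum_deg a) (bigD1 i)//= leq_addr. Qed.

Lemma deg_inj a b : deg a =1 deg b -> a = b.
Proof. by move=> e; do 2 apply: val_inj; apply/mnmP. Qed.

Lemma multiindex_of (e : 'I_n -> nat) : (\sum_(i < n) e i = m)%N ->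
  exists a, deg a =1 e.
Proof.
move=> em; pose f := Multinom [tuple e i | i < n].
have fE i : f i = e i by rewrite /f mnmE.
have fm : mdeg f = m by rewrite mdegE -[RHS]em; apply: eq_bigr => i _; exact: fE.
have fb : (mdeg f < m.+1)%N by rewrite fm.
have fm' : mdeg (BMultinom fb) == m by rewrite /= fm.
by exists (exist _ (BMultinom fb) fm').
Qed.

Definition bad a := [exists i, (1 < deg a i)%N].

Lemma mon_good a x : ~~ bad a ->
  mon a x = \prod_(i in [set i | deg a i != 0%N]%SET) x i.
Proof.
move=> /existsPn good; rewrite [RHS]big_mkcond; apply: eq_bigr => i _.
by rewrite inE; have := good i; case: (deg a i) => [|[|]].
Qed.

(* The variables (i, j) with j < deg a i stand for the deg a i factors x i of the
   monomial a, so that [mon_slots] makes it multilinear. *)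
Definition slots a := [set p : 'I_n * 'I_m | (p.2 < deg a p.1)%N]%SET.

Lemma mon_slots a x : mon a x = \prod_(p in slots a) x p.1.
Proof.
rewrite (eq_bigl (fun p : 'I_n * 'I_m => true && (p.2 < deg a p.1)%N)); last first.
  by move=> p; rewrite inE.
rewrite -(pair_big_dep xpredT (fun i (j : 'I_m) => (j < deg a i)%N)
  (fun i _ => x i)) /=.
apply: eq_bigr => i _.
by rewrite -(big_ord_widen m (fun=> x i) (deg_le a i)) prodr_const card_ord.
Qed.

Definition ev (C : mi -> R) x := \sum_a C a * mon a x.

(** At a vertex the multilinear part is the polynomial minus the remainder, hence at most [V + U].
    This bound extends to the cube, and restoring the remainder costs [U] once more. *)
Lemma ev_le (C : mi -> R) (U V : R) :
  (forall e : {ffun 'I_n -> bool}, `|ev C (fun i => (-1) ^+ e i)| <= V) ->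
  (forall e : {ffun 'I_n * 'I_m -> bool},
     `|\sum_a (if bad a then C a else 0) * \prod_(p in slots a) (-1) ^+ e p| <= U) ->
  forall x, (forall i, `|x i| <= 1) -> `|ev C x| <= V + 2 * U.
Proof.
move=> hV hU.
have decomp x : ev C x = \sum_a (if bad a then 0 else C a) *
    \prod_(i in [set i | deg a i != 0%N]%SET) x i +
    \sum_a (if bad a then C a else 0) * \prod_(p in slots a) x p.1.
  rewrite -big_split /=; apply: eq_bigr => a _; rewrite -mon_slots.
  by case: ifPn => [_|/mon_good <-]; rewrite mul0r ?add0r ?addr0.
have rem x : (forall i, `|x i| <= 1) ->
    `|\sum_a (if bad a then C a else 0) * \prod_(p in slots a) x p.1| <= U.
  by move=> x1; apply: (multilinear_bound (x := fun p => x p.1)).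
have good x : (forall i, `|x i| <= 1) -> `|\sum_a (if bad a then 0 else C a) *
    \prod_(i in [set i | deg a i != 0%N]%SET) x i| <= V + U.
  move=> x1; apply: multilinear_bound => // e.
  have := decomp (fun i => (-1) ^+ e i) => /eqP; rewrite -subr_eq => /eqP <-.
  rewrite (le_trans (ler_normB _ _))// lerD//.
  apply: (rem (fun i => (-1) ^+ e i)) => i.
  by rewrite normrX normrN1 expr1n.
move=> x x1; rewrite decomp (le_trans (ler_normD _ _))//.
by have := rem x x1; have := good x x1; lra.
Qed.

End monomials.

(** Lists the variables of a monomial of degree [k] with repetition, removing one factor at a time;
    monomials can then be counted through functions. *)
Lemma nat_fun_units n k (e : 'I_n -> nat) : (\sum_(i < n) e i = k)%N ->
  exists f : 'I_k -> 'I_n, forall i, e i = (\sum_(j < k) (f j == i))%N.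
Proof.
elim: k e => [|k IH] e ek.
  have e0 i : e i = 0%N.
    by apply/eqP; have /eqP := ek; rewrite sum_nat_eq0 => /forallP/(_ i).
  have f : 'I_0 -> 'I_n by case.
  by exists f => i; rewrite big_ord0 e0.
have [i0 ei0] : exists i, (0 < e i)%N.
  apply/existsP; rewrite -[X in is_true X]negbK negb_exists; apply/negP => /forallP h.
  suff : (\sum_(i < n) e i = 0)%N by rewrite ek.
  by apply: big1 => i _; have := h i; rewrite lt0n negbK => /eqP.
have [|f fE] := IH (fun i => e i - (i == i0))%N.
  rewrite sumnB => [|i _]; last by case: eqP => // ->.
  by rewrite ek (bigD1 i0)//= eqxx big1 ?addn0 ?subn1// => i /negbTE ->.
exists (fun j => if unlift ord0 j is Some j' then f j' else i0) => i.
rewrite big_ord_recl unlift_none.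
under eq_bigr do rewrite liftK.
rewrite -fE eq_sym subnKC//.
by case: eqP => // ->.
Qed.

(** A bad monomial is the square of one variable times [m - 2] further ones, so [m - 1] choices of a
    variable determine it. *)
Lemma card_bad n m : (0 < m)%N ->
  (#|[set a : multiindex n m | bad a]%SET| <= n ^ m.-1)%N.
Proof.
have bad_sub k (a : multiindex n k) : bad a -> exists i0, exists f : 'I_k.-2 -> 'I_n,
    (1 < k)%N /\
    forall i, deg a i = ((i0 == i) + (i0 == i) + \sum_(j < k.-2) (f j == i))%N.
  move=> /existsP[i0 ai0]; exists i0.
  have k1 : (1 < k)%N by exact: leq_trans ai0 (deg_le a i0).
  have [|f fE] := @nat_fun_units n k.-2 (fun i => deg a i - (i0 == i).*2)%N.
    rewrite sumnB => [|i _]; last by case: eqP => // <-.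
    rewrite sum_deg (bigD1 i0)//= eqxx big1 ?addn0 ?subn2// => i.
    by rewrite eq_sym => /negbTE ->.
  exists f; split => // i; rewrite -fE addnn subnKC//.
  by case: eqP => // <-.
(* In degree 1 there is no bad monomial: [bad_sub] would give [1 < 1]. *)
case: m => // -[|m] _ /=.
  rewrite eq_card0// => a; rewrite !inE.
  by case ba: (bad a) => //; have [i0 [f []]] := bad_sub _ _ ba.
have /choice[F FP] : forall a : multiindex n m.+2,
    exists f : {ffun 'I_m.+1 -> 'I_n}, bad a ->
    forall i, deg a i = ((f ord0 == i) + \sum_(j < m.+1) (f j == i))%N.
  move=> a; have [ba|nb] := boolP (bad a).
    have [i0 [f [_ fE]]] := bad_sub _ _ ba.
    exists [ffun j => if unlift ord0 j is Some j' then f j' else i0] => _ i.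
    rewrite big_ord_recl !ffunE unlift_none fE addnA; congr (_ + _)%N.
    by apply: eq_bigr => j _; rewrite ffunE liftK.
  (* Off the bad monomials any value of [F] will do; a variable exists since the degrees have a
     positive sum. *)
  have [i _] : exists i : 'I_n, True.
    case: (pickP 'I_n) => [i _|n0]; first by exists i.
    have := sum_deg a; rewrite big1// => i; by have := n0 i.
  by exists [ffun=> i].
rewrite -(card_in_imset (f := F)); last first.
  move=> a b; rewrite !inE => ba bb Fab; apply: deg_inj => i.
  by rewrite (FP a ba) (FP b bb) Fab.
by rewrite (leq_trans (max_card _))// card_ffun !card_ord.
Qed.

(** * Blocks of variables and the lower bound on the maximum *)

Section blocks.
Context (R : realType) (n m' : nat).
Local Notation m := m'.+1.
Local Notation mi := (multiindex n m).
Implicit Types (a : mi) (x y : 'I_n -> R).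

Definition blk (v : 'I_n) : 'I_m := inord (v %% m)%N.

Lemma blkE v : blk v = (v %% m)%N :> nat.
Proof. by rewrite inordK// ltn_mod. Qed.

Definition one_per_block a := [forall j, \sum_(v | blk v == j) deg a v == 1]%N.

Lemma one_per_block_le1 a v : one_per_block a -> (deg a v <= 1)%N.
Proof.
move=> /forallP/(_ (blk v))/eqP <-.
by rewrite (bigD1 v)//= leq_addr.
Qed.

(* Averaging over the signs t of the blocks kills the monomials having an even
   degree in some block; m odd block degrees with sum m are all equal to 1. *)
Lemma one_per_block_extract (C : mi -> R) (M : R) y :
  (forall x, (forall i, `|x i| <= 1) -> `|ev C x| <= M) ->
  (forall i, `|y i| <= 1) ->
  `|\sum_(a | one_per_block a) C a * mon a y| <= M.
Proof.
move=> hM y1.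
pose T : finType := {ffun 'I_m -> bool}.
pose x (t : T) v := (-1) ^+ t (blk v) * y v.
have xE (t : T) a : mon a (x t) =
    (\prod_(j < m) (-1) ^+ (t j * \sum_(v | blk v == j) deg a v)) * mon a y.
  rewrite /mon /x; under eq_bigr do rewrite exprMn.
  rewrite big_split /=; congr (_ * _).
  rewrite (partition_big blk xpredT)//=; apply: eq_bigr => j _.
  rewrite big_distrr /= -prodrXr; apply: eq_bigr => v /eqP <-.
  by rewrite exprM.
have avg a : \sum_(t : T) (\prod_(j < m) (-1) ^+ t j) *
    (\prod_(j < m) (-1) ^+ (t j * \sum_(v | blk v == j) deg a v)) =
    if one_per_block a then 2 ^+ m else 0 :> R.
  under eq_bigr do rewrite -big_split /=.
  pose F j (b : bool) : R :=
    (-1) ^+ b * (-1) ^+ (b * \sum_(v | blk v == j) deg a v).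
  rewrite -(bigA_distr_bigA F) /F.
  under eq_bigr do rewrite big_bool /= mul1n mul0n !expr0 mulr1 expr1 mulN1r.
  have sumd : (\sum_(j < m) \sum_(v | blk v == j) deg a v = m)%N.
    by rewrite -[RHS](sum_deg a) [in RHS](partition_big blk xpredT).
  have [/forallP tr|ntr] := boolP (one_per_block a).
    rewrite (eq_bigr (fun=> 2)) ?prodr_const ?card_ord// => j _.
    by rewrite (eqP (tr j)) expr1 opprK.
  have [j ev] : exists j, ~~ odd (\sum_(v | blk v == j) deg a v).
    apply/existsP; rewrite -negb_forall; apply: contra ntr => /forallP od.
    have ge1 j : (1 <= \sum_(v | blk v == j) deg a v)%N.
      by case: (\sum_(v | _) _)%N (od j).
    have /leqif_sum : forall j : 'I_m, true ->
      (1 <= \sum_(v | blk v == j) deg a v ?=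
        iff (\sum_(v | blk v == j) deg a v == 1))%N.
      by move=> j _; split; [exact: ge1|rewrite eq_sym].
    rewrite sum1_card card_ord => -[_]; rewrite sumd eqxx => /esym/forallP h.
    by apply/forallP => j; exact: h.
  by rewrite (bigD1 j)//= -signr_odd (negbTE ev) expr0 addNr mul0r.
have key : \sum_(t : T) (\prod_(j < m) (-1) ^+ t j) * ev C (x t) =
    2 ^+ m * \sum_(a | one_per_block a) C a * mon a y.
  under eq_bigr do rewrite /ev mulr_sumr.
  rewrite exchange_big mulr_sumr [RHS]big_mkcond; apply: eq_bigr => a _ /=.
  transitivity (C a * mon a y * if one_per_block a then 2 ^+ m else 0).
    rewrite -avg mulr_sumr; apply: eq_bigr => t _.
    by rewrite xE; set p := \prod_j _; set q := \prod_j _; ring.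
  by case: ifP => _; rewrite ?mulr0// mulrC.
have cT : #|T| = (2 ^ m)%N by rewrite card_ffun card_bool card_ord.
rewrite -(@ler_pM2l _ (2 ^+ m)) ?exprn_gt0// -[X in X * `|_|]ger0_norm ?exprn_ge0//.
rewrite -normrM -key (le_trans (ler_norm_sum _ _ _))//.
rewrite (_ : 2 ^+ m * M = \sum_(t : T) M); last first.
  by rewrite sumr_const cT -[RHS]mulr_natl natrX.
apply: ler_sum => t _; rewrite normrM normr_prod big1 ?mul1r; last first.
  by move=> j _; rewrite normrX normrN1 expr1n.
apply: hM => v; rewrite normrM normrX normrN1 expr1n mul1r; exact: y1.
Qed.

Definition lastblk := [set v : 'I_n | blk v == ord_max]%SET.

(** A monomial with one variable per block contains exactly one [v] of the last block. Evaluating at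
    the sign of [D v] on that block and at 1 elsewhere turns the extracted sum into the sum of the
    [|D v|]. *)
Lemma sum_abs_extract (C : mi -> R) (M : R) :
  (forall x, (forall i, `|x i| <= 1) -> `|ev C x| <= M) ->
  \sum_(v in lastblk) `|\sum_(a | one_per_block a && (deg a v == 1%N)) C a| <= M.
Proof.
move=> hM; pose D v := \sum_(a | one_per_block a && (deg a v == 1%N)) C a.
pose y v : R := if v \in lastblk then (-1) ^+ (D v < 0)%R else 1.
have y1 v : `|y v| <= 1.
  by rewrite /y; case: ifP => _; rewrite ?normr1// normrX normrN1 expr1n.
apply: le_trans (ler_norm _) _.
rewrite (_ : \sum_(v in _) _ = \sum_(a | one_per_block a) C a * mon a y).
  exact: one_per_block_extract.
have mon_y a : one_per_block a ->
    mon a y = \sum_(v in lastblk) if deg a v == 1%N then y v else 0.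
  move=> /forallP/(_ ord_max)/sum_nat_eq1[v0 [v0l d1 d0]].
  have v0B : v0 \in lastblk by rewrite inE.
  rewrite (bigD1 v0)//= d1 eqxx big1 ?addr0; last first.
    by move=> v /andP[]; rewrite inE => vl nv; rewrite d0// eq_sym.
  rewrite /mon (bigD1 v0)//= /deg in d1 *; rewrite d1 expr1 big1 ?mulr1// => v nv.
  rewrite /y; case: ifP => [|_]; last by rewrite expr1n.
  rewrite inE => vl; rewrite [multiindex_mnm a v](d0 v) ?expr0// eq_sym//.
under [RHS]eq_bigr => a tr do rewrite mon_y// mulr_sumr.
rewrite exchange_big; apply: eq_bigr => v vB.
rewrite -/(D v) -[LHS]mulr1.
transitivity (D v * y v).
  by rewrite /y vB mulr1; have [d0|d0] := ltP (D v) 0;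
    [rewrite ltr0_norm// expr1 mulrN1|rewrite ger0_norm// expr0 mulr1].
rewrite /D mulr_suml [LHS]big_mkcondr; apply: eq_bigr => a tr.
by case: ifP => _; rewrite ?mulr0.
Qed.

Lemma card_lastblk : (n %/ m <= #|lastblk|)%N.
Proof.
(* The indices [k * m + m'] have residue [m'] and so lie in the last block. *)
have lt (k : 'I_(n %/ m)) : (k * m + m' < n)%N.
  rewrite -addnS (leq_trans _ (leq_trunc_div n m))// addnC -mulSn leq_mul2r.
  by rewrite ltn_ord orbT.
pose h k := Ordinal (lt k).
have hinj : injective h.
  move=> k k' /(congr1 val)/= /eqP; rewrite eqn_add2r eqn_mul2r => /eqP e.
  exact: val_inj.
rewrite -[X in (X <= _)%N]card_ord -(card_imset _ hinj) subset_leq_card//.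
apply/fintype.subsetP => _ /imsetP[k _ ->]; rewrite inE -val_eqE /= blkE /=.
by rewrite modnMDl modn_small.
Qed.

(** In each of the other [m'] blocks, one of the [n %/ m] indices [k * m + j] can be chosen freely;
    multiplying these variables by that of [v] gives distinct monomials. *)
Lemma card_one_per_block v : v \in lastblk ->
  ((n %/ m) ^ m' <= #|[set a : mi | one_per_block a && (deg a v == 1%N)]%SET|)%N.
Proof.
rewrite inE => /eqP vl; set p := (n %/ m)%N.
have lt (j : 'I_m') (k : 'I_p) : (k * m + j < n)%N.
  rewrite (leq_trans _ (leq_trunc_div n m))// (@leq_trans (k * m + m))//.
    by rewrite ltn_add2l ltnW// ltnS ltn_ord.
  by rewrite addnC -mulSn leq_mul2r ltn_ord orbT.
pose w j k := Ordinal (lt j k).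
have blkw j k : blk (w j k) = widen_ord (leqnSn m') j.
  by apply: ord_inj; rewrite blkE /= modnMDl modn_small// ltnW// ltnS ltn_ord.
have wv j k : (w j k == v) = false.
  apply/eqP => e; move: vl; rewrite -e blkw => /(congr1 val)/= jm.
  by have := ltn_ord j; rewrite jm ltnn.
pose e (f : {ffun 'I_m' -> 'I_p}) u := ((v == u) + \sum_(j < m') (w j (f j) == u))%N.
have sum1 (P : pred 'I_n) w0 : (\sum_(u | P u) (w0 == u) = P w0)%N.
  have [Pw|nPw] := boolP (P w0).
    by rewrite (bigD1 w0)//= eqxx big1// => u /andP[_]; rewrite eq_sym => /negbTE ->.
  by rewrite big1// => u Pu; case: eqP nPw Pu => // -> /negbTE ->.
have sume f : (\sum_(u < n) e f u = m)%N.
  rewrite big_split /= sum1 exchange_big /=.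
  by under eq_bigr do rewrite sum1; rewrite sum1_card card_ord.
have /choice[A AE] := fun f => multiindex_of (sume f).
have Ainj : injective A.
  move=> f f' ff; apply/ffunP => j.
  have := AE f (w j (f j)); rewrite ff AE /e eq_sym wv add0n => eff.
  (* The variable chosen by [f] in block [j] must occur among those of [f']; its residue forces
     [j' = j], and its quotient gives [f j = f' j]. *)
  have [j' /eqP wj] : exists j', w j' (f' j') == w j (f j).
    apply/existsP; case: existsP => // nex; move: eff.
    rewrite add0n big1 => [|j' _]; last first.
      by case: eqP => // e'; case: nex; exists j'; apply/eqP.
    by rewrite (bigD1 j)//= eqxx.
  have /(congr1 blk) := wj; rewrite !blkw => /(congr1 val)/= /val_inj j'j.
  have /(congr1 val)/= /eqP := wj; rewrite j'j eqn_add2r eqn_mul2r /= => /eqP e'.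
  exact/esym/val_inj.
rewrite -[X in (X ^ _)%N](card_ord p) -[X in (_ ^ X)%N](card_ord m') -card_ffun.
rewrite -(card_imset _ Ainj) subset_leq_card//.
apply/fintype.subsetP => _ /imsetP[f _ ->]; rewrite inE AE /e eqxx big1 ?addn0;
  last first.
  by move=> j _; rewrite wv.
rewrite andbT; apply/forallP => jj.
under eq_bigr do rewrite AE.
rewrite big_split /= sum1 exchange_big /=.
under eq_bigr do rewrite sum1 blkw.
(* The number 1 is written as the sum of the indicator of [jj] over all blocks, the last term being
   the contribution of [v]. *)
have := sum1_card (pred1 jj); rewrite card1 big_mkcond big_ord_recr /= => e1.
rewrite vl addnC -[X in _ == X]e1; apply/eqP; congr (_ + _)%N.
Qed.

End blocks.

(** * Exponential moments of Gaussian vectors *)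

Section normal_exp.
Context (R : realType).
Local Notation mu := (@lebesgue_measure R).

(** The Radon-Nikodym derivative and the explicit density have the same integral over every
    measurable set, so they agree almost everywhere. *)
Lemma ge0_integral_normal_prob (a s : R) (f : R -> \bar R) :
  measurable_fun setT f -> (forall x, 0 <= f x)%E ->
  (\int[normal_prob a s]_x f x = \int[mu]_x (f x * (normal_pdf a s x)%:E))%E.
Proof.
move=> mf f0.
have dom := normal_prob_dominates a s.
have fint := Radon_Nikodym_SigmaFinite.f_integrable dom.
rewrite -(Radon_Nikodym_SigmaFinite.change_of_variables dom)//.
apply: ae_eq_integral => //.
- by apply: emeasurable_funM => //; exact: measurable_int fint.
- apply: emeasurable_funM => //.
  by apply/measurable_EFinP; exact: measurable_normal_pdf.
- apply: ae_eqe_mul2l; apply: integral_ae_eq => //.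
  + by apply/measurable_EFinP; exact: measurable_normal_pdf.
  + by move=> E _ mE; rewrite -Radon_Nikodym_SigmaFinite.f_integral.
Qed.

Lemma integral_normal_prob_expR (c : R) :
  (\int[normal_prob (0 : R) 1]_x (expR (c * x))%:E = (expR (c ^+ 2 / 2))%:E)%E.
Proof.
(* Completing the square: the exponential tilt moves the density to mean [c]. *)
have shift x : expR (c * x) * normal_pdf 0 1 x =
    expR (c ^+ 2 / 2) * normal_pdf c 1 x.
  rewrite !normal_pdfE ?oner_eq0//= mulrCA [RHS]mulrCA; congr (_ * _).
  by rewrite /normal_fun -!expRD; congr expR; rewrite expr1n; field.
rewrite ge0_integral_normal_prob; last 2 first.
- apply/measurable_EFinP; exact: measurableT_comp.
- by move=> x; rewrite lee_fin expR_ge0.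
under eq_integral => x _.
  rewrite -EFinM shift EFinM; over.
rewrite ge0_integralZl//=.
- by rewrite integral_normal_pdf mule1.
- by apply/measurable_EFinP; exact: measurable_normal_pdf.
- by move=> x _; rewrite lee_fin normal_pdf_ge0.
Qed.

End normal_exp.

Section gaussian_mean.
Context (R : realType).
Local Notation RR := (measurableTypeR R).

Definition linform k (c : 'I_k -> R) (g : k.-tuple RR) : R :=
  \sum_(i < k) c i * tnth g i.

Lemma measurable_linform k (c : 'I_k -> R) : measurable_fun setT (linform c).
Proof.
apply: measurable_sum => i; apply: measurable_funM => //.
exact: measurable_tnth.
Qed.

(** Induction on [k]: Tonelli separates the first coordinate, and the exponential factors. *)
Lemma integral_expR_linform k (c : 'I_k -> R) :
  (\int[gaussian_tuple R k]_g (expR (linform c g))%:E =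
   (expR ((\sum_(i < k) c i ^+ 2) / 2))%:E)%E.
Proof.
have mexp k' (c' : 'I_k' -> R) :
    measurable_fun setT (fun g => (expR (linform c' g))%:E).
  apply/measurable_EFinP; apply: measurableT_comp => //.
  exact: measurable_linform.
elim: k c => [|k IH] c.
  rewrite integral_dirac//; last exact: mexp.
  by rewrite /linform !big_ord0 mul0r diracT mul1e.
transitivity (\int[(normal_prob (0 : R) 1 \x gaussian_tuple R k)%E]_xt
    ((fun g => (expR (linform c g))%:E) \o @tuple_cons R k) xt)%E.
  by apply: ge0_integral_distribution => //; exact: mexp.
have E xt : ((fun g => (expR (linform c g))%:E) \o @tuple_cons R k) xt =
   ((expR (c ord0 * xt.1))%:E *
    (expR (linform (fun i => c (lift ord0 i)) xt.2))%:E)%E.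
  rewrite /= -EFinM -expRD /linform big_ord_recl /=.
  congr (expR (_ + _))%:E.
  by apply: eq_bigr => i _; congr (_ * _); rewrite !(tnth_nth 0).
under eq_integral do rewrite E.
rewrite fubini_tonelli1 //=; last first.
  apply: emeasurable_funM.
    apply/measurable_EFinP; apply: measurableT_comp => //.
    exact: (measurableT_comp (mulrl_measurable _)).
  by apply: (measurableT_comp (mexp _ _)); exact: measurable_snd.
rewrite /fubini_F /=.
under eq_integral => x _.
  rewrite ge0_integralZl//=; last exact: mexp.
  rewrite IH.
  over.
rewrite ge0_integralZr//=.
  by rewrite integral_normal_prob_expR -EFinM -expRD big_ord_recl /= mulrDl.
by apply/measurable_EFinP; exact: measurableT_comp.
Qed.

End gaussian_mean.

Section has_mean.
Context d (T : measurableType d) (R : realType) (P : probability T R).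
Implicit Types (F G : T -> R) (u v t : R).

(** Integrability and the value of the mean are bundled so that linear combinations carry both
    along. *)
Definition has_mean F v :=
  P.-integrable setT (EFin \o F) /\ (\int[P]_w (F w)%:E = v%:E)%E.

Lemma has_mean_measurable F v : has_mean F v -> measurable_fun setT F.
Proof. by move=> [/measurable_int /measurable_EFinP]. Qed.

Lemma has_mean_cst v : has_mean (fun=> v) v.
Proof.
split; first exact: finite_measure_integrable_cst.
by rewrite integral_cst//= probability_setT mule1.
Qed.

Lemma has_meanD F G u v :
  has_mean F u -> has_mean G v -> has_mean (fun w => F w + G w) (u + v).
Proof.
move=> [iF eF] [iG eG]; split; first exact: (integrableD _ iF iG).
under eq_integral do rewrite EFinD.
by rewrite integralD// eF eG.
Qed.

Lemma has_meanZ (a : R) F u : has_mean F u -> has_mean (fun w => a * F w) (a * u).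
Proof.
move=> [iF eF]; split; first exact: (integrableZl _ _ iF).
under eq_integral do rewrite EFinM.
by rewrite integralZl// eF.
Qed.

Lemma has_mean_sum (I : finType) (F : I -> T -> R) (u : I -> R) :
  (forall i, has_mean (F i) (u i)) ->
  has_mean (fun w => \sum_i F i w) (\sum_i u i).
Proof.
move=> h.
have E : (fun w => \sum_i F i w) = \sum_i F i.
  by apply/funext => w; rewrite fct_sumE.
rewrite E; elim/big_ind2 : _ => [|f a g b|i _] //.
- exact: has_mean_cst.
- exact: has_meanD.
Qed.

Lemma markov_has_mean F v t : (forall w, 0 <= F w) -> has_mean F v -> 0 < t ->
  (P [set w | (t <= F w)%R] <= (v / t)%:E)%E.
Proof.
move=> F0 hF t0; have mF := has_mean_measurable hF; case: hF => iF eF.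
have mA : measurable [set w | t <= F w].
  by rewrite -[X in measurable X]setTI; exact: measurable_fun_le.
rewrite EFinM lee_pdivlMr// -eF muleC -integral_cst//.
rewrite (@le_trans _ _ (\int[P]_(w in [set w | (t <= F w)%R]) (F w)%:E)%E)//.
- apply: ge0_le_integral => //.
  + by move=> w _; rewrite lee_fin ltW.
  + by apply/measurable_EFinP; exact: measurable_funTS.
- apply: ge0_subset_integral => //; first exact/measurable_EFinP.
  by move=> w _; rewrite lee_fin.
Qed.

End has_mean.

(** * Hyperbolic cosines of Gaussian linear forms *)

Section hyperbolic_cosine.
Context (R : realType).

Definition cosh (x : R) := (expR x + expR (- x)) / 2.

Lemma cosh_ge0 (x : R) : 0 <= cosh x.
Proof. by rewrite /cosh divr_ge0// addr_ge0// expR_ge0. Qed.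

Lemma coshM (x y : R) : cosh x * cosh y = (cosh (x + y) + cosh (x - y)) / 2.
Proof.
rewrite /cosh opprD opprB !expRD; set a := expR x; set b := expR y.
set a' := expR (- x); set b' := expR (- y); by field.
Qed.

Lemma cosh_ge1 (x : R) : 1 <= cosh x.
Proof.
have h1 := expR_ge1Dx x; have h2 := expR_ge1Dx (- x).
by rewrite /cosh ler_pdivlMr//; lra.
Qed.

(** This turns a lower bound on a sum of [cosh] into one on a sum of absolute values. If
    [cosh x <= a], use [cosh x - 1 <= |x| cosh x]; otherwise [cosh x] is at most [cosh x ^+ 2 / a],
    and the square is at most [cosh (2 * x)]. *)
Lemma cosh_le (a x : R) : 0 < a -> cosh x - 1 <= a * `|x| + cosh (2 * x) / a.
Proof.
move=> a0.
have dbl : cosh x * cosh x <= cosh (2 * x).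
  rewrite coshM subrr (_ : x + x = 2 * x); last by ring.
  have -> : cosh 0 = 1 :> R by rewrite /cosh oppr0 expR0; field.
  by have := cosh_ge1 (2 * x); lra.
have [Ca|aC] := leP (cosh x) a.
  have e0 := expR_gt0 x; have e0' := expR_gt0 (- x).
  have ee : expR x * expR (- x) = 1 by rewrite -expRD subrr expR0.
  have h1 : expR x * (1 - x) <= 1.
    by rewrite -[leRHS]ee ler_pM2l//; have := expR_ge1Dx (- x); lra.
  have h2 : expR (- x) * (1 + x) <= 1.
    by rewrite -[leRHS]ee [leLHS]mulrC ler_pM2r// expR_ge1Dx.
  have h3 : x * expR x <= `|x| * expR x by rewrite ler_pM2r// ler_norm.
  have h4 : - x * expR (- x) <= `|x| * expR (- x).
    by rewrite ler_pM2r// -normrN ler_norm.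
  have h5 : cosh x - 1 <= `|x| * cosh x.
    by rewrite /cosh mulrA ler_pdivlMr// mulrBl divfK//; lra.
  rewrite (le_trans h5)// (@le_trans _ _ (a * `|x|))//.
    by rewrite mulrC ler_wpM2r.
  by rewrite lerDl divr_ge0// ?cosh_ge0// ltW.
rewrite (@le_trans _ _ (cosh (2 * x) / a))//; last first.
  by rewrite lerDr mulr_ge0// ltW.
rewrite ler_pdivlMr//; apply: le_trans dbl.
have := cosh_ge1 x => C1.
by rewrite mulrC ler_pM//; [exact: ltW|lra|exact: ltW|lra].
Qed.

End hyperbolic_cosine.

Section gaussian_cosh.
Context (R : realType) (k : nat).
Local Notation mu := (gaussian_tuple R k).
Implicit Types c : 'I_k -> R.

Definition dotp c c' := \sum_(i < k) c i * c' i.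

Lemma linformD c c' g : linform (fun i => c i + c' i) g = linform c g + linform c' g.
Proof. by rewrite /linform -big_split; apply: eq_bigr => i _; rewrite mulrDl. Qed.

Lemma linformB c c' g : linform (fun i => c i - c' i) g = linform c g - linform c' g.
Proof. by rewrite /linform -sumrB; apply: eq_bigr => i _; rewrite mulrBl. Qed.

Lemma linformZ (a : R) c g : linform (fun i => a * c i) g = a * linform c g.
Proof. by rewrite /linform mulr_sumr; apply: eq_bigr => i _; rewrite mulrA. Qed.

Lemma has_mean_cosh c :
  has_mean mu (fun g => cosh (linform c g)) (expR (dotp c c / 2)).
Proof.
have he c' : has_mean mu (fun g => expR (linform c' g)) (expR (dotp c' c' / 2)).
  have mf : measurable_fun setT (fun g => (expR (linform c' g))%:E).
    apply/measurable_EFinP; apply: measurableT_comp => //.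
    exact: measurable_linform.
  have E : (\int[mu]_g (expR (linform c' g))%:E = (expR (dotp c' c' / 2))%:E)%E.
    by rewrite integral_expR_linform; congr (expR (_ / _))%:E; apply: eq_bigr.
  split => //; apply/integrableP; split => //.
  under eq_integral do rewrite gee0_abs ?lee_fin ?expR_ge0//.
  by rewrite E ltry.
have hN : dotp (fun i => - c i) (fun i => - c i) = dotp c c.
  by apply: eq_bigr => i _; rewrite mulrNN.
have lN g : linform (fun i => - c i) g = - linform c g.
  by rewrite /linform -sumrN; apply: eq_bigr => i _; rewrite mulNr.
rewrite (_ : (fun _ => _) =
  fun g => 2^-1 * (expR (linform c g) + expR (linform (fun i => - c i) g))).
  rewrite (_ : expR _ = 2^-1 * (expR (dotp c c / 2) + expR (dotp c c / 2)));
    last by field.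
  by apply: has_meanZ; apply: has_meanD => //; rewrite -[in expR _]hN.
by apply/funext => g; rewrite lN /cosh mulrC.
Qed.

Section orthonormal.
Context (I : finType) (c : I -> 'I_k -> R).
Hypothesis orthoc : forall i j, dotp (c i) (c j) = (i == j)%:R.

(** [kappa] and [var] are the mean and the variance of [cosh] of a standard Gaussian. *)
Let kappa : R := expR (1 / 2).
Let var : R := (1 + expR 2) / 2 - expR 1.

Let kappaM : kappa * kappa = expR 1.
Proof. by rewrite -expRD; congr expR; field. Qed.

Let mean_cosh i : has_mean mu (fun g => cosh (linform (c i) g)) kappa.
Proof. by have := has_mean_cosh (c i); rewrite orthoc eqxx. Qed.

(** The product of the [cosh] is half the sum of the [cosh] of [cp] and [cm]. For [i != j] both have
    squared norm 2, so its mean is [expR 1 = kappa * kappa] and the covariance vanishes; for [i = j]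
    the squared norms are 4 and 0. *)
Let mean_coshM i j : has_mean mu
  (fun g => (cosh (linform (c i) g) - kappa) * (cosh (linform (c j) g) - kappa))
  (if i == j then var else 0).
Proof.
pose cp l := c i l + c j l; pose cm l := c i l - c j l.
have E (u : R) :
    (fun g => (cosh (linform (c i) g) - u) * (cosh (linform (c j) g) - u)) =
    (fun g => 2^-1 * (cosh (linform cp g) + cosh (linform cm g)) +
      ((- u) * cosh (linform (c i) g) +
      ((- u) * cosh (linform (c j) g) + u * u))).
  apply/funext => g; rewrite linformD linformB.
  have := coshM (linform (c i) g) (linform (c j) g).
  move: (cosh _) (cosh _) (cosh _) (cosh _) => p q r t e.
  by transitivity (t * r - u * t - u * r + u * u); [ring|rewrite e; field].
have dotE (a : R) (c' := fun l => c i l + a * c j l) :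
    dotp c' c' = 1 + (1 + 1) * a * (i == j)%:R + a * a.
  transitivity (dotp (c i) (c i) + (1 + 1) * a * dotp (c i) (c j)
     + a * a * dotp (c j) (c j)); last by rewrite !orthoc !eqxx mulr1.
  by rewrite /dotp !mulr_sumr -!big_split; apply: eq_bigr => l _; rewrite /c' /=; ring.
have dotp_cp : dotp cp cp / 2 = 1 + (i == j)%:R.
  have -> : cp = (fun l => c i l + 1 * c j l).
    by apply/funext => l; rewrite mul1r.
  by rewrite dotE; field.
have dotp_cm : dotp cm cm / 2 = 1 - (i == j)%:R.
  have -> : cm = (fun l => c i l + (-1) * c j l).
    by apply/funext => l; rewrite mulN1r.
  by rewrite dotE; field.
have -> : (if i == j then var else 0) =
   2^-1 * (expR (dotp cp cp / 2) + expR (dotp cm cm / 2)) +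
   ((- kappa) * kappa + ((- kappa) * kappa + kappa * kappa)).
  rewrite dotp_cp dotp_cm mulNr kappaM /var.
  by case: eqP => _; rewrite ?subrr ?subr0 ?addr0 ?expR0; field.
rewrite E; apply: has_meanD.
  by apply: has_meanZ; apply: has_meanD; exact: has_mean_cosh.
apply: has_meanD; first exact: has_meanZ (mean_cosh i).
apply: has_meanD; last exact: has_mean_cst.
exact: has_meanZ (mean_cosh j).
Qed.

Lemma has_mean_sqr_cosh : has_mean mu
  (fun g => (\sum_i (cosh (linform (c i) g) - kappa)) ^+ 2) (#|I|%:R * var).
Proof.
rewrite (_ : (fun _ => _) = fun g => \sum_i \sum_j
  (cosh (linform (c i) g) - kappa) * (cosh (linform (c j) g) - kappa)); last first.
  apply/funext => g; rewrite expr2 mulr_suml.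
  by apply: eq_bigr => i _; rewrite mulr_sumr.
rewrite (_ : #|I|%:R * var =
  \sum_(i : I) \sum_(j : I) (if i == j then var else 0)); last first.
  rewrite (eq_bigr (fun=> var)) ?sumr_const ?mulr_natl// => i _.
  by rewrite -big_mkcond (big_pred1 i)// => j; rewrite /= eq_sym.
apply: has_mean_sum => i; apply: has_mean_sum => j; exact: mean_coshM.
Qed.

Let has_mean_cosh2 : has_mean mu
  (fun g => \sum_i cosh (2 * linform (c i) g)) (#|I|%:R * expR 2).
Proof.
rewrite mulr_natl -sumr_const; apply: has_mean_sum => i.
have -> : (fun g => cosh (2 * linform (c i) g)) =
    (fun g => cosh (linform (fun l => 2 * c i l) g)).
  by apply/funext => g; rewrite linformZ.
rewrite (_ : expR 2 =
  expR (dotp (fun l => 2 * c i l) (fun l => 2 * c i l) / 2)).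
  exact: has_mean_cosh.
congr expR; transitivity (2 * dotp (c i) (c i)).
  by rewrite orthoc eqxx mulr1.
rewrite /dotp mulr_sumr mulr_suml; by apply: eq_bigr => l _; field.
Qed.

(** Write [b] for the number of forms. By Chebyshev the sum of the [cosh] exceeds
    [b * (kappa - 1/4)], hence [5/4 * b]; subtracting [b] leaves [b / 4]. By Markov the error term
    of [cosh_le] takes at most [b / 8] of this, so [a] times the sum of absolute values is at least
    [b / 8]. *)
Lemma sum_abs_linform (a : R) : 0 < a -> (0 < #|I|)%N ->
  exists2 E : set (k.-tuple (measurableTypeR R)), measurable E /\
    (mu E <= (16 * var / #|I|%:R + 8 * expR 2 / a)%:E)%E &
    forall g, ~ E g -> #|I|%:R / (8 * a) <= \sum_i `|linform (c i) g|.
Proof.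
move=> a0 I0; set b : R := #|I|%:R.
have b0 : 0 < b by rewrite ltr0n.
pose F1 g := (\sum_i (cosh (linform (c i) g) - kappa)) ^+ 2.
pose F2 g := \sum_i cosh (2 * linform (c i) g).
pose E1 := [set g | (b / 4) ^+ 2 <= F1 g].
pose E2 := [set g | a * b / 8 <= F2 g].
have mE1 : measurable E1.
  rewrite -[E1]setTI; apply: measurable_fun_le => //.
  exact: has_mean_measurable has_mean_sqr_cosh.
have mE2 : measurable E2.
  rewrite -[E2]setTI; apply: measurable_fun_le => //.
  exact: has_mean_measurable has_mean_cosh2.
have PE1 : (mu E1 <= (16 * var / b)%:E)%E.
  rewrite (_ : 16 * var / b = b * var / (b / 4) ^+ 2); last first.
    by field; rewrite gt_eqF.
  apply: markov_has_mean has_mean_sqr_cosh _; first by move=> g; rewrite sqr_ge0.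
  by rewrite exprn_gt0// divr_gt0.
have PE2 : (mu E2 <= (8 * expR 2 / a)%:E)%E.
  rewrite (_ : 8 * expR 2 / a = b * expR 2 / (a * b / 8)); last first.
    by field; rewrite !gt_eqF.
  apply: markov_has_mean has_mean_cosh2 _; last by rewrite divr_gt0// mulr_gt0.
  by move=> g; apply: sumr_ge0 => i _; rewrite cosh_ge0.
exists (E1 `|` E2).
  split; first exact: measurableU.
  by rewrite EFinD (le_trans (measureU2 _ _ _))// leeD.
move=> g /not_orP[/negP + /negP]; rewrite -!ltNge => h1 h2.
have {}h1 : `|\sum_i (cosh (linform (c i) g) - kappa)| < b / 4.
  rewrite -(@ltr_pXn2r _ 2)// ?nnegrE ?divr_ge0 ?(ltW b0)//.
  by rewrite real_normK ?num_real.
have k32 : 3 / 2 <= kappa by have := expR_ge1Dx (1 / 2 : R); rewrite /kappa; lra.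
have h3 : \sum_i (cosh (linform (c i) g) - 1) <=
    a * \sum_i `|linform (c i) g| + F2 g / a.
  rewrite mulr_sumr mulr_suml -big_split /=.
  by apply: ler_sum => i _; exact: cosh_le.
move: h1; rewrite ltr_norml => /andP[h1 _].
have sB (u : R) : \sum_i (cosh (linform (c i) g) - u) =
    \sum_i cosh (linform (c i) g) - b * u.
  by rewrite sumrB sumr_const -[u *+ _]mulr_natl.
move: h1 h3; rewrite !sB => h1 h3.
have h4 : F2 g / a < b / 8.
  by rewrite ltr_pdivrMr// mulrC mulrA.
have h5 : 3 / 2 * b <= b * kappa by rewrite mulrC ler_pM2l.
move: (kappa) (\sum_i cosh _) h1 h3 h5 => u s h1 h3 h5.
rewrite ler_pdivrMr ?mulr_gt0// mulrC -mulrA.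
by move: (a * _) h3 => r h3; lra.
Qed.

End orthonormal.
End gaussian_cosh.

(** * Measurability of the two maxima *)

Lemma cvg_ev (R : realType) n m (C : multiindex n m -> R) (y : nat -> 'I_n -> R) x :
  (forall i, y k i @[k --> \oo] --> x i) -> ev C (y k) @[k --> \oo] --> ev C x.
Proof.
move=> yx; rewrite /ev /mon; apply: cvg_big => [|a _]; first exact: add_continuous.
apply: cvgM; first exact: cvg_cst.
apply: cvg_big => [|i _]; first exact: mul_continuous.
elim: (deg a i) => [|d IH]; first by under eq_fun do rewrite expr0; exact: cvg_cst.
by rewrite exprS; under eq_fun do rewrite exprS; exact: cvgM.
Qed.

Section cube_max_measurable.
Context (R : realType) (n m : nat).
Implicit Types (P : dhomog n R m) (x : 'I_n -> R).

Lemma meval_dhomog P x :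
  meval x (val P) = ev (fun a : multiindex n m => dhomog_coef (multiindex_mnm a) P) x.
Proof.
have sz : (mmeasure (@mdeg n) (val P) <= m.+1)%N.
  rewrite mmeasureE; apply/bigmax_leqP_seq => a aP _.
  by rewrite ltnS; have /dhomogP/(_ _ aP) -> := valP P.
rewrite [in LHS](mpolywE sz) raddf_sum /=.
under eq_bigr do rewrite mevalZ mevalX.
(* The expansion runs over all degrees up to [m]; homogeneity kills the lower ones. *)
rewrite (bigID (fun a : bmultinom n m.+1 => mdeg a == m)) /= [X in _ + X]big1 ?addr0.
  exact: (big_sub (fun a : bmultinom n m.+1 => mdeg a == m)
    (fun a => mcoeff a (val P) * \prod_i x i ^+ (bmnm a) i)).
by move=> a am; rewrite (dhomog_nemf_coeff (valP P) am) mul0r.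
Qed.

Lemma meval_gaussian_poly g x : meval x (val (@gaussian_poly R n m g)) =
  ev (fun a => Num.sqrt (multinomial_coef R a) * tnth g (enum_rank a)) x.
Proof.
rewrite /gaussian_poly raddf_sum raddf_sum; apply: eq_bigr => a _ /=.
by rewrite mevalZ mevalX.
Qed.

(** Evaluation is a finite linear combination of the coefficient maps, which generate the
    sigma-algebra. *)
Lemma measurable_meval x : measurable_fun setT (fun P => meval x (val P)).
Proof.
rewrite (_ : (fun _ => _) = fun P =>
  \sum_(a : multiindex n m) dhomog_coef (multiindex_mnm a) P * mon a x); last first.
  by apply/funext => P; rewrite meval_dhomog.
apply: measurable_sum => a; apply: measurable_funM => //.
move=> _ A mA; rewrite setTI; apply: sub_gen_smallest.
by exists (multiindex_mnm a) => //; exists A => //; rewrite setTI.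
Qed.

Lemma measurable_vertex_max : measurable_fun setT (@vertex_max R n m).
Proof.
rewrite /vertex_max; elim: (index_enum _) => [|e s IH].
  under eq_fun do rewrite big_nil.
  exact: measurable_cst.
under eq_fun do rewrite big_cons.
apply: measurable_maxr => //; apply: measurableT_comp => //.
exact: measurable_meval.
Qed.

Definition cube : set ('I_n -> R) := [set x | forall i, -1 <= x i <= 1].

(** Supplies the upper bound that makes the [sup] in [cube_max] a genuine supremum. *)
Lemma cube_ev_bound P x : cube x ->
  `|meval x (val P)| <= \sum_(a : multiindex n m) `|dhomog_coef (multiindex_mnm a) P|.
Proof.
move=> xc; rewrite meval_dhomog (le_trans (ler_norm_sum _ _ _))//.
apply: ler_sum => a _; rewrite normrM ler_piMr// normr_prod.
rewrite prodr_ile1// => i _; rewrite normr_ge0 normrX exprn_ile1//.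
by rewrite ler_norml; exact: xc.
Qed.

Lemma cube_max_ub P x : cube x -> `|meval x (val P)| <= cube_max P.
Proof.
move=> xc; apply: ub_le_sup; last by exists x.
by eexists => _ [z zc <-]; exact: cube_ev_bound.
Qed.

Lemma cube_max_le P (U : R) : (forall x, cube x -> `|meval x (val P)| <= U) ->
  cube_max P <= U.
Proof.
move=> h; apply: ge_sup.
  by exists `|meval (fun=> 0) (val P)|; exists (fun=> 0) => // i; rewrite lerN10 ler01.
by move=> _ [x xc <-]; exact: h.
Qed.

Lemma vertex_max_ub P (e : {ffun 'I_n -> bool}) :
  `|meval (fun i => (-1) ^+ e i) (val P)| <= vertex_max P.
Proof. by apply: (le_bigmax _ (fun e : {ffun 'I_n -> bool} => _ : R)). Qed.

Lemma vertex_max_le_cube_max P : vertex_max P <= cube_max P.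
Proof.
apply: bigmax_le => [|e _].
  by apply: le_trans (cube_max_ub P (x := fun=> 0) _) => // i; rewrite lerN10 ler01.
apply: cube_max_ub => i; case: (e i); rewrite ?expr1 ?expr0; lra.
Qed.

(* Enumerates the rational points of the cube; codes of other points give 0. *)
Definition grid_point (k : nat) : 'I_n -> R :=
  if unpickle k is Some p then
    let: (N, z) := p : nat * {ffun 'I_n -> int} in
    if [forall i, `|z i| <= N.+1%:Z] then fun i => (z i)%:~R / N.+1%:R else fun=> 0
  else fun=> 0.

Lemma grid_point_cube k : cube (grid_point k).
Proof.
have c0 : cube (fun=> 0) by move=> i; rewrite lerN10 ler01.
rewrite /grid_point; case: unpickle => [[N z]|//].
case: ifPn => [/forallP h|//] i.
have := h i; rewrite -(ler_int R) intr_norm -ler_norml normrM normfV => zN.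
by rewrite [`|N.+1%:R|]ger0_norm// ler_pdivrMr ?mul1r.
Qed.

(** Rounding each coordinate down to a multiple of [1 / N.+1] moves it by at most [harmonic N]. *)
Lemma grid_dense x : cube x -> exists k : nat -> nat,
  forall i, grid_point (k N) i @[N --> \oo] --> x i.
Proof.
move=> xc.
pose z N : {ffun 'I_n -> int} := [ffun i => Num.floor (x i * N.+1%:R)].
exists (fun N => pickle (N, z N)) => i.
(* The rounded point stays in the cube, so its code does not fall into the default case of
   [grid_point]. *)
have zb N j : `|z N j| <= N.+1%:Z.
  have /andP[x1 x2] := xc j; rewrite ffunE ler_norml; apply/andP; split.
    by rewrite floor_ge_int mulrNz -mulN1r ler_pM2r.
  by rewrite -(ler_int R) (le_trans (floor_le _))// -[leRHS]mul1r ler_pM2r.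
have gE N : grid_point (pickle (N, z N)) i = (z N i)%:~R / N.+1%:R.
  rewrite /grid_point pickleK; case: ifPn => // /forallPn[j].
  by rewrite zb.
under eq_fun do rewrite gE.
apply: (@squeeze_cvgr _ _ _ _ (fun N => x i - harmonic N) (fun=> x i)).
- apply: nearW => N; have /andP[f1 f2] := floor_itv (x i * N.+1%:R).
  rewrite ffunE /harmonic ler_pdivlMr// ler_pdivrMr// f1 andbT mulrBl mulVf//.
  by rewrite lerBlDr; move: f2; rewrite intrD => /ltW.
- by rewrite -[X in _ --> X]subr0; apply: cvgB; [exact: cvg_cst|exact: cvg_harmonic].
- exact: cvg_cst.
Qed.

(** By density and continuity a countable supremum suffices, which gives measurability. *)
Lemma cube_max_sups P :
  cube_max P = sups (fun k => `|meval (grid_point k) (val P)|) 0%N.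
Proof.
set s := sups _ _.
have sub k : `|meval (grid_point k) (val P)| <= s.
  apply: ub_le_sup; last by exists k.
  by eexists => _ [j _ <-]; apply: cube_max_ub; exact: grid_point_cube.
apply/eqP; rewrite eq_le; apply/andP; split.
  apply: cube_max_le => x xc; have [k kx] := grid_dense xc.
  have h : `|meval (grid_point (k N)) (val P)| @[N --> \oo] -->
      `|meval x (val P)|.
    apply: cvg_norm; rewrite meval_dhomog.
    by under eq_fun do rewrite meval_dhomog; exact: cvg_ev.
  apply: (@cvgr_to_le _ _ _ R _ _ _ h); exact: nearW.
apply: ge_sup; first by exists `|meval (grid_point 0) (val P)|; exists 0%N.
by move=> _ [j _ <-]; apply: cube_max_ub; exact: grid_point_cube.
Qed.

Lemma measurable_cube_max : measurable_fun setT (@cube_max R n m).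
Proof.
rewrite (_ : @cube_max R n m = fun P =>
  sups (fun k => `|meval (grid_point k) (val P)|) 0%N); last first.
  by apply/funext => P; exact: cube_max_sups.
apply: measurable_fun_sups => [P _|k].
  by eexists => _ [j _ <-]; apply: cube_max_ub; exact: grid_point_cube.
by apply: measurableT_comp => //; exact: measurable_meval.
Qed.

End cube_max_measurable.

(** * Estimates for the random polynomial *)

Section max_linform.
Context (R : realType) (k : nat).
Local Notation mu := (gaussian_tuple R k).

(** A union bound in exponential form: [expR (lam * |l|) <= 2 * cosh (lam * l)], and Markov's
    inequality is applied to the sum of the right-hand sides over all forms. *)
Lemma max_abs_linform (I : finType) (c : I -> 'I_k -> R) (s2 lam U : R) :
  0 < lam -> (forall i, dotp (c i) (c i) <= s2) ->
  exists2 E : set (k.-tuple (measurableTypeR R)), measurable E /\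
    (mu E <= (#|I|%:R * (2 * expR (lam ^+ 2 * s2 / 2 - lam * U)))%:E)%E &
    forall g, ~ E g -> forall i, `|linform (c i) g| <= U.
Proof.
move=> lam0 cs2; pose F g := \sum_i 2 * cosh (lam * linform (c i) g).
pose v i := expR (lam ^+ 2 * dotp (c i) (c i) / 2).
have mF : has_mean mu F (\sum_i 2 * v i).
  apply: has_mean_sum => i; apply: has_meanZ.
  have -> : (fun g => cosh (lam * linform (c i) g)) =
      (fun g => cosh (linform (fun l => lam * c i l) g)).
    by apply/funext => g; rewrite linformZ.
  rewrite /v (_ : lam ^+ 2 * _ = dotp (fun l => lam * c i l) (fun l => lam * c i l)).
    exact: has_mean_cosh.
  by rewrite /dotp mulr_sumr; apply: eq_bigr => l _; ring.
exists [set g | expR (lam * U) <= F g].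
  split.
    rewrite -[X in measurable X]setTI; apply: measurable_fun_le => //.
    exact: has_mean_measurable mF.
  apply: le_trans (markov_has_mean _ mF _) _; rewrite ?expR_gt0//.
    by move=> g; apply: sumr_ge0 => i _; rewrite mulr_ge0// cosh_ge0.
  rewrite lee_fin mulr_natl -sumr_const mulr_suml; apply: ler_sum => i _.
  rewrite ler_pdivrMr ?expR_gt0// -[leRHS]mulrA -expRD subrK.
  rewrite ler_pM2l// ler_expR ler_pM2r//.
  by rewrite ler_pM2l ?exprn_gt0.
move=> g /negP; rewrite -ltNge => FU i.
rewrite -(ler_pM2l lam0) -ler_expR ltW//; apply: le_lt_trans FU.
apply: (@le_trans _ _ (2 * cosh (lam * linform (c i) g))); last first.
  rewrite /F (bigD1 i)//= lerDl sumr_ge0// => j _.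
  by rewrite mulr_ge0// cosh_ge0.
have -> : lam * `|linform (c i) g| = `|lam * linform (c i) g|.
  by rewrite normrM (gtr0_norm lam0).
rewrite /cosh [leRHS]mulrC divfK//.
by case: ger0P => _; rewrite ?lerDl ?lerDr expR_ge0.
Qed.

End max_linform.

Section coefficients.
Context (R : realType) (n m : nat).
Local Notation mi := (multiindex n m).
Local Notation N := #|{: mi}|.
Local Notation mc := (@multinomial_coef R n m).
Implicit Types (w : mi -> R) (a : mi).

Definition gcoef (g : N.-tuple (measurableTypeR R)) a : R :=
  Num.sqrt (mc a) * tnth g (enum_rank a).

(** Coordinates, in the independent standard Gaussians, of the form with weights [w] on the random
    coefficients. *)
Definition cvec w (l : 'I_N) : R := w (enum_val l) * Num.sqrt (mc (enum_val l)).

Lemma linform_cvec w g : linform (cvec w) g = \sum_a w a * gcoef g a.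
Proof.
rewrite (reindex (@enum_val _ (mem {: mi}))) /=; last first.
  by exists enum_rank => a _; [exact: enum_valK|exact: enum_rankK].
by apply: eq_bigr => l _; rewrite /gcoef enum_valK mulrA.
Qed.

Lemma prod_fact_gt0 a : 0 < \prod_(i < n) ((multiindex_mnm a i)`!)%:R :> R.
Proof. by apply: prodr_gt0 => i _; rewrite ltr0n fact_gt0. Qed.

Lemma mc_ge0 a : 0 <= mc a.
Proof. by rewrite divr_ge0// ltW// prod_fact_gt0. Qed.

Lemma mc_le a : mc a <= m`!%:R.
Proof.
rewrite ler_pdivrMr ?prod_fact_gt0// ler_peMr// -natr_prod ler1n.
by apply: prodn_gt0 => i; exact: fact_gt0.
Qed.

Lemma dotp_cvec w w' : dotp (cvec w) (cvec w') = \sum_a w a * w' a * mc a.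
Proof.
rewrite [RHS](reindex (@enum_val _ (mem {: mi}))) /=; last first.
  by exists enum_rank => a _; [exact: enum_valK|exact: enum_rankK].
apply: eq_bigr => l _; rewrite /cvec mulrACA -expr2 sqr_sqrtr//.
exact: mc_ge0.
Qed.

End coefficients.

Section remainder.
Context (R : realType) (n m : nat).
Local Notation mi := (multiindex n m).
Local Notation mu := (gaussian_tuple R #|{: mi}|).

Lemma remainder_bound : (0 < m)%N -> (0 < n)%N ->
  exists2 E : set (#|{: mi}|.-tuple (measurableTypeR R)), measurable E /\
    (mu E <= (2 * expR (- n%:R))%:E)%E &
    forall g, ~ E g -> forall e : {ffun 'I_n * 'I_m -> bool},
     `|\sum_a (if bad a then gcoef g a else 0) * \prod_(p in slots a) (-1) ^+ e p|
       <= (m + 2)%:R * Num.sqrt m`!%:R * Num.sqrt n%:R ^+ m.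
Proof.
move=> m0 n0; set r := Num.sqrt n%:R.
have r0 : 0 < r by rewrite sqrtr_gt0 ltr0n.
have r2 : r ^+ 2 = n%:R by rewrite sqr_sqrtr.
pose q : R := Num.sqrt m`!%:R.
have q0 : 0 < q by rewrite sqrtr_gt0 ltr0n fact_gt0.
have q2 : q ^+ 2 = m`!%:R by rewrite sqr_sqrtr.
pose s := q * r ^+ m.-1.
have s0 : 0 < s by rewrite mulr_gt0// exprn_gt0.
pose w (e : {ffun 'I_n * 'I_m -> bool}) (a : mi) : R :=
  if bad a then \prod_(p in slots a) (-1) ^+ e p else 0.
have ws e : dotp (cvec (w e)) (cvec (w e)) <= s ^+ 2.
  rewrite dotp_cvec.
  apply: (@le_trans _ _ (\sum_(a in [set a : mi | bad a]%SET) m`!%:R)).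
    rewrite [leRHS]big_mkcond; apply: ler_sum => a _; rewrite inE /w.
    case: ifP => ba; rewrite ?mul0r// -expr2 -prodrXl big1 ?mul1r ?mc_le// => p _.
    by rewrite sqrr_sign.
  rewrite sumr_const -[leLHS]mulr_natr exprMn q2 ler_wpM2l//.
  rewrite exprAC r2 -natrX ler_nat; exact: card_bad.
(* The choice [lam = r / s] makes the variance term [n / 2] and the threshold term [(m + 2) * n]. *)
have [E [mE PE] EP] := @max_abs_linform R _ _ (fun e => cvec (w e)) (s ^+ 2) (r / s)
  ((m + 2)%:R * q * r ^+ m) (divr_gt0 r0 s0) ws.
exists E => [|g Eg e]; last first.
  have := EP g Eg e; rewrite linform_cvec; congr (`|_| <= _).
  by apply: eq_bigr => a _; rewrite /w; case: ifP => _; rewrite ?mul0r// mulrC.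
split=> //; apply: le_trans PE _; rewrite lee_fin.
have -> : (r / s) ^+ 2 * s ^+ 2 / 2 = n%:R / 2.
  by rewrite expr_div_n divfK ?expf_eq0 ?gt_eqF// r2.
have -> : r / s * ((m + 2)%:R * q * r ^+ m) = (m + 2)%:R * n%:R.
  rewrite -r2 -[in r ^+ m](prednK m0) exprS /s; field.
  by rewrite expf_neq0 ?gt_eqF// andbT gt_eqF.
have -> : #|{ffun 'I_n * 'I_m -> bool}|%:R = 2 ^+ (n * m) :> R.
  by rewrite card_ffun card_bool card_prod !card_ord natrX.
(* The number of vertices is thus at most [expR (n * m)], and the total exponent
   [n m + n / 2 - (m + 2) n] is below [- n]. *)
have two_e : 2 <= expR 1 :> R by have := expR_ge1Dx (1 : R); rewrite -natr1; lra.
have h : 2 ^+ (n * m) <= expR (n * m)%:R :> R.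
  by rewrite -[(n * m)%:R]mulr1 expRM_natl lerXn2r// ?nnegrE ?expR_ge0.
rewrite mulrCA ler_pM2l// (le_trans (ler_wpM2r (expR_ge0 _) h))//.
rewrite -expRD ler_expR natrM natrD.
have : 0 <= n%:R :> R by [].
by move: (n%:R : R) => x x0; nra.
Qed.

End remainder.

Section lower_bound.
Context (R : realType) (n m' : nat).
Local Notation m := m'.+1.
Local Notation mi := (multiindex n m).
Local Notation mu := (gaussian_tuple R #|{: mi}|).
Local Notation mc := (@multinomial_coef R n m).

Lemma mc_one_per_block_ge1 (a : mi) : one_per_block a -> 1 <= mc a.
Proof.
move=> tr; rewrite /multinomial_coef big1 ?divr1 ?ler1n ?fact_gt0// => i _.
by have := one_per_block_le1 i tr; rewrite /deg; case: (multiindex_mnm a i) => [|[|]].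
Qed.

(** Distinct [v] in the last block therefore use disjoint sets of monomials, which makes the sums
    [D v] uncorrelated. *)
Lemma one_per_block_unique (a : mi) v v' : one_per_block a ->
  v \in lastblk n m' -> v' \in lastblk n m' ->
  deg a v = 1%N -> deg a v' = 1%N -> v = v'.
Proof.
rewrite !inE => /forallP/(_ ord_max)/eqP tr vl v'l d d'.
apply/eqP; apply: contraTT isT => nvv'; move: tr.
by rewrite (bigD1 v)//= (bigD1 v')/= ?v'l ?(eq_sym v') ?nvv'// d d'.
Qed.

Definition block_weight v (a : mi) : R := (one_per_block a && (deg a v == 1%N))%:R.

(** The variance of the sum of the random coefficients over the one-per-block monomials containing
    [v]. *)
Definition block_var v : R := \sum_a block_weight v a * block_weight v a * mc a.

Lemma block_var_ge v : v \in lastblk n m' ->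
  ((n %/ m) ^ m')%:R <= block_var v.
Proof.
move=> vl; have := card_one_per_block vl; rewrite -(ler_nat R) => /le_trans; apply.
rewrite /block_var -sum1_card natr_sum big_mkcond; apply: ler_sum => a _.
rewrite inE /block_weight; case: ifPn => [/andP[tr _]|_]; last by rewrite mul0r mul0r.
by rewrite !mul1r mc_one_per_block_ge1.
Qed.

(** Divided by their standard deviations [sg], the sums over the last block become orthonormal
    forms, to which [sum_abs_linform] applies; undoing the division gains a factor of at least
    [Num.sqrt p ^+ m']. *)
Lemma linear_form_bound (a : R) : 0 < a -> (m <= n)%N ->
  let p : R := (n %/ m)%:R in
  exists2 E : set (#|{: mi}|.-tuple (measurableTypeR R)), measurable E /\
    (mu E <= (16 * ((1 + expR 2) / 2 - expR 1) / p + 8 * expR 2 / a)%:E)%E &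
    forall g, ~ E g -> Num.sqrt p ^+ m' * p / (8 * a) <=
      \sum_(v in lastblk n m')
        `|\sum_(b | one_per_block b && (deg b v == 1%N)) gcoef g b|.
Proof.
move=> a0 mn p.
have p0 : 0 < p by rewrite ltr0n divn_gt0.
pose B := lastblk n m'.
pose vv (i : 'I_#|B|) := enum_val i.
have vB i : vv i \in B by exact: enum_valP.
have var0 i : 0 < block_var (vv i).
  apply: lt_le_trans (block_var_ge (vB i)).
  by rewrite ltr0n expn_gt0 divn_gt0// mn.
pose sg i := Num.sqrt (block_var (vv i)).
have sg0 i : 0 < sg i by rewrite sqrtr_gt0.
pose w i (b : mi) := (sg i)^-1 * block_weight (vv i) b.
have orth i j : dotp (cvec (w i)) (cvec (w j)) = (i == j)%:R.
  rewrite dotp_cvec; have [->|ij] := eqVneq i j.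
    transitivity ((sg j ^+ 2)^-1 * block_var (vv j)).
      rewrite /block_var mulr_sumr; apply: eq_bigr => b _; rewrite /w.
      by rewrite -exprVn; ring.
    by rewrite sqr_sqrtr ?mulVf ?gt_eqF// ltW.
  apply: big1 => b _; rewrite /w /block_weight.
  case: (boolP (one_per_block b)) => tr; last by rewrite !mulr0 !mul0r.
  case: (eqVneq (deg b (vv i)) 1%N) => [di|_]; last by rewrite !(mulr0, mul0r).
  case: (eqVneq (deg b (vv j)) 1%N) => [dj|_]; last by rewrite !(mulr0, mul0r).
  case/eqP: ij; apply: enum_val_inj.
  exact: (one_per_block_unique tr (vB i) (vB j)).
have cB : p <= #|B|%:R by rewrite ler_nat; exact: card_lastblk.
have B0 : (0 < #|'I_#|B| |)%N.
  by rewrite card_ord -(ltr0n R) (lt_le_trans p0).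
have [E [mE PE] EP] := sum_abs_linform orth a0 B0.
rewrite card_ord in PE EP.
exists E => [|g Eg].
  split=> //; apply: le_trans PE _; rewrite lee_fin lerD2r.
  (* This variance equals [(expR 1 - 1) ^+ 2 / 2]; its sign allows replacing the block size by the
     smaller [p]. *)
  have v0 : 0 <= 16 * ((1 + expR 2) / 2 - expR 1) :> R.
    have -> : expR 2 = expR 1 ^+ 2 :> R by rewrite -expRM_natl mulr1.
    by have := sqr_ge0 (expR 1 - 1 : R); nra.
  by rewrite ler_wpM2l// lef_pV2 ?posrE// (lt_le_trans p0).
have := EP g Eg => h.
rewrite (big_enum_val (fun v : 'I_n =>
  `|\sum_(b | one_per_block b && (deg b v == 1%N)) gcoef g b|)) /=.
apply: (@le_trans _ _ (Num.sqrt p ^+ m' * \sum_i `|linform (cvec (w i)) g|)).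
  rewrite -mulrA ler_pM2l ?exprn_gt0 ?sqrtr_gt0//; apply: le_trans h.
  by rewrite ler_pM2r// invr_gt0 mulr_gt0.
rewrite mulr_sumr; apply: ler_sum => i _; rewrite linform_cvec.
have -> : \sum_(b : mi) w i b * gcoef g b = (sg i)^-1 *
    \sum_(b | one_per_block b && (deg b (vv i) == 1%N)) gcoef g b.
  rewrite mulr_sumr [RHS]big_mkcond; apply: eq_bigr => b _.
  by rewrite /w /block_weight; case: ifP => _; rewrite ?mulr1// !(mulr0, mul0r).
rewrite normrM gtr0_norm ?invr_gt0// mulrA ler_piMl//.
rewrite ler_pdivrMr ?mul1r// -[leLHS]ger0_norm ?exprn_ge0// -sqrtr_sqr.
rewrite ler_wsqrtr// -exprM mulnC exprM sqr_sqrtr ?(ltW p0)// -natrX.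
exact: block_var_ge.
Qed.

End lower_bound.

(** * The good event and convergence in probability *)

Section good_event.
Context (R : realType).

(** Positivity excludes [P = 0], where the inequality holds but the quotient takes the default value
    0. *)
Definition good n m (beta : R) : set (dhomog n R m) :=
  [set P | 0 < cube_max P /\ (1 - n%:R `^ (- beta)) * cube_max P <= vertex_max P].

Lemma measurable_vertex_ratio n m (t : R) : measurable
  [set P : dhomog n R m | (1 - t) * cube_max P <= vertex_max P].
Proof.
rewrite -[X in measurable X]setTI; apply: measurable_fun_le => //.
  by apply: measurable_funM => //; exact: measurable_cube_max.
exact: measurable_vertex_max.
Qed.

Lemma measurable_good n m beta : measurable (@good n m beta).
Proof.
apply: measurableI; last exact: measurable_vertex_ratio.
rewrite -[X in measurable X]setTI.
rewrite (_ : _ `&` _ = ~` [set P : dhomog n R m | cube_max P <= 0]); last first.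
  apply/seteqP; split => P /=; first by move=> [_]; rewrite ltNge => /negP.
  by move=> /negP; rewrite -ltNge.
apply: measurableC; rewrite -[X in measurable X]setTI.
by apply: measurable_fun_le => //; exact: measurable_cube_max.
Qed.

(* With a = sqrt n / (K n^beta), the bounds 2 U on the error and
   sqrt n ^ (m + 1) / (8 a L) on the maximum have ratio exactly n^-beta. *)
Lemma good_prob m (m_gt0 : (0 < m)%N) (beta : R) : 0 < beta ->
  exists C : R, forall n, (m <= n)%N ->
    (bombieri_gaussian R n m (~` good beta) <= (C * n%:R `^ (beta - 1 / 2))%:E)%E.
Proof.
case: m m_gt0 => // m' _ beta0; set m := m'.+1.
pose q : R := Num.sqrt m`!%:R.
have q0 : 0 < q by rewrite sqrtr_gt0 ltr0n fact_gt0.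
pose L : R := Num.sqrt (2 * m%:R) ^+ m.+1.
have L0 : 0 < L by rewrite exprn_gt0// sqrtr_gt0 mulr_gt0// ltr0n.
pose K : R := 16 * L * (m + 2)%:R * q.
have m2 : 0 < (m + 2)%:R :> R by rewrite ltr0n addn2.
have K0 : 0 < K by apply: mulr_gt0 => //; apply: mulr_gt0 => //; exact: mulr_gt0.
pose var : R := (1 + expR 2) / 2 - expR 1.
have var0 : 0 <= var.
  have -> : var = (expR 1 - 1) ^+ 2 / 2.
    rewrite /var; have -> : expR 2 = expR 1 ^+ 2 :> R by rewrite -expRM_natl mulr1.
    by field.
  by rewrite divr_ge0// sqr_ge0.
exists (2 + 16 * var * (2 * m%:R) + 8 * expR 2 * K) => n mn.
have n0 : (0 < n)%N by exact: leq_trans mn.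
have n0R : 0 < n%:R :> R by rewrite ltr0n.
pose r : R := Num.sqrt n%:R.
have r0 : 0 < r by rewrite sqrtr_gt0.
have rE : r = n%:R `^ (1 / 2) by rewrite mul1r powR12_sqrt// ltW.
pose nb : R := n%:R `^ beta.
have nb0 : 0 < nb by rewrite powR_gt0.
pose a := r / (K * nb).
have a0 : 0 < a by rewrite divr_gt0// mulr_gt0.
pose p : R := (n %/ m)%:R.
have p0 : 0 < p by rewrite ltr0n divn_gt0.
(* Since [m <= n], the remainder of the division is at most [m * (n %/ m)]. *)
have np : n%:R <= 2 * m%:R * p.
  rewrite -!natrM ler_nat {1}(divn_eq n m) -mulnA mul2n -addnn mulnC leq_add2l.
  by rewrite (leq_trans (ltnW (ltn_pmod _ _)))// leq_pmulr// divn_gt0.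
have [E1 [mE1 PE1] EP1] := @remainder_bound R n m isT n0.
have [E2 [mE2 PE2] EP2] := @linear_form_bound R n m' a a0 mn.
have sub : gaussian_poly (R := R) (n := n) (m := m) @^-1` (~` good beta) `<=` E1 `|` E2.
  move=> g ng; apply: contrapT => /not_orP[g1 g2]; apply: ng.
  have {}EP1 := EP1 g g1; have {}EP2 := EP2 g g2.
  set P := gaussian_poly g; pose M := cube_max P.
  pose U := (m + 2)%:R * q * r ^+ m.
  have evP x : meval x (val P) = ev (gcoef g) x by exact: meval_gaussian_poly.
  have cubeE (x : 'I_n -> R) : (forall i, `|x i| <= 1) -> cube x.
    by move=> x1 i; rewrite -ler_norml.
  have MV : M <= vertex_max P + 2 * U.
    apply: cube_max_le => x xc; rewrite evP; apply: ev_le EP1 _ _.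
      by move=> e; rewrite -evP; exact: vertex_max_ub.
    by move=> i; rewrite ler_norml; exact: xc.
  have ML : Num.sqrt p ^+ m' * p / (8 * a) <= M.
    apply: le_trans EP2 _; apply: sum_abs_extract => x x1.
    by rewrite -evP; apply: cube_max_ub; exact: cubeE.
  have rp : r ^+ m.+1 <= L * (Num.sqrt p ^+ m' * p).
    have -> : L * (Num.sqrt p ^+ m' * p) = (Num.sqrt (2 * m%:R) * Num.sqrt p) ^+ m.+1.
      rewrite exprMn; congr (_ * _); rewrite -[X in _ * X](@sqr_sqrtr _ p) ?(ltW p0)//.
      by rewrite -exprD addn2.
    by rewrite lerXn2r ?nnegrE ?mulr_ge0 ?sqrtr_ge0// -sqrtrM ?mulr_ge0// ler_wsqrtr.
  have ML' : 2 * U * nb <= M.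
    apply: le_trans ML; rewrite ler_pdivlMr; last exact: mulr_gt0.
    rewrite -(ler_pM2l L0); apply: le_trans rp.
    have -> // : L * (2 * U * nb * (8 * a)) = r ^+ m.+1.
    rewrite /a /K /U exprS; field; rewrite !gt_eqF//.
  have U0 : 0 < U.
    by apply: mulr_gt0; [exact: mulr_gt0|exact: exprn_gt0].
  split; first by apply: lt_le_trans ML'; apply: mulr_gt0 => //; exact: mulr_gt0.
  rewrite powRN mulrBl mul1r lerBlDr (le_trans MV)// lerD2l.
  by rewrite ler_pdivlMl// mulrC.
rewrite -[leLHS]/(gaussian_tuple R _ (gaussian_poly (R := R) (n := n) (m := m) @^-1` _)).
apply: (@le_trans _ _ (gaussian_tuple R #|{: multiindex n m}| (E1 `|` E2))).
  apply: le_measure => //; rewrite inE; last exact: measurableU.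
  by apply: measurable_funPTI; apply: measurableC; exact: measurable_good.
apply: le_trans (measureU2 _ mE1 mE2) _; apply: le_trans (leeD PE1 PE2) _.
rewrite -EFinD lee_fin -/var -/p.
(* Each of the three error terms [expR (- n)], [1 / p] and [1 / a] is at most a constant times
   [u]. *)
pose u : R := n%:R `^ (beta - 1 / 2).
have nu : n%:R^-1 <= u.
  by rewrite -powR_inv1 ?(ltW n0R)// /u ler_powR ?ler1n//; lra.
have e1 : expR (- n%:R) <= u.
  apply: le_trans nu; rewrite expRN lef_pV2 ?posrE ?expR_gt0//.
  by rewrite (le_trans _ (expR_ge1Dx _))// lerDr.
have e2 : p^-1 <= 2 * m%:R * u.
  apply: (@le_trans _ _ (2 * m%:R * n%:R^-1)); last first.
    by rewrite ler_pM2l// mulr_gt0// ltr0n.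
  by rewrite -[leLHS]mul1r ler_pdivrMr// mulrAC ler_pdivlMr// mul1r.
have e3 : a^-1 = K * u.
  rewrite /a /u invf_div rE powRB; last by apply/implyP => _; rewrite gt_eqF.
  by rewrite mulrA.
rewrite -/u e3 addrA.
have -> : (2 + 16 * var * (2 * m%:R) + 8 * expR 2 * K) * u =
    2 * u + 16 * var * (2 * m%:R * u) + 8 * expR 2 * (K * u).
  by move: (var) (m%:R : R) (expR 2) (K) u {nu e1 e2 e3} => x1 x2 x3 x4 x5; ring.
apply: lerD => //; apply: lerD; first by rewrite ler_pM2l.
by apply: ler_wpM2l => //; apply: mulr_ge0.
Qed.

Lemma near_powRN (gamma eps : R) : 0 < gamma -> 0 < eps ->
  \forall n \near \oo, n%:R `^ (- gamma) <= eps.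
Proof.
move=> gamma0 eps0; near=> n.
have h : eps^-1 `^ gamma^-1 <= n%:R by near: n; exact: nbhs_infty_ger.
have n0 : 0 < n%:R :> R by apply: lt_le_trans h; rewrite powR_gt0 ?invr_gt0.
rewrite powRN invf_ple ?posrE ?powR_gt0//.
have -> : eps^-1 = (eps^-1 `^ gamma^-1) `^ gamma.
  by rewrite -powRrM mulVf ?gt_eqF// powRr1// invr_ge0 ltW.
by apply: ge0_ler_powR => //; rewrite ?nnegrE ?powR_ge0// ltW.
Unshelve. all: by end_near. Qed.

Lemma cvg_powRN (gamma : R) : 0 < gamma -> n%:R `^ (- gamma) @[n --> \oo] --> (0 : R).
Proof.
move=> gamma0; apply/cvgrPdist_le => eps eps0.
near=> n; rewrite sub0r normrN ger0_norm ?powR_ge0//.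
by near: n; exact: near_powRN.
Unshelve. all: by end_near. Qed.

(** Every convergence claim reduces to events eventually contained in the complement of [good]. Here
    [beta < 1 / 2] makes the exponent in [good_prob] negative. *)
Lemma cvg_bad m (m_gt0 : (0 < m)%N) (beta : R) (A : forall n, set (dhomog n R m)) :
  0 < beta < 1 / 2 -> (forall n, measurable (A n)) ->
  (\forall n \near \oo, A n `<=` ~` good beta) ->
  bombieri_gaussian R n m (A n) @[n --> \oo] --> 0%E.
Proof.
move=> /andP[b0 b2] mA Ag; have [C CP] := good_prob m_gt0 b0.
apply: (@squeeze_cvge _ _ _ _ (fun=> 0%E) _
  (fun n => (C * n%:R `^ (- (1 / 2 - beta)))%:E)).
- near=> n; rewrite measure_ge0 /= opprB.
  have mn : (m <= n)%N by near: n; exact: nbhs_infty_ge.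
  apply: le_trans (CP n mn); apply: le_measure; rewrite ?inE.
  + exact: mA.
  + by apply: measurableC; exact: measurable_good.
  + by near: n.
- exact: cvg_cst.
- apply: cvg_EFin; first by near=> n.
  rewrite -[X in _ --> X](mulr0 C); apply: cvgM; first exact: cvg_cst.
  by apply: cvg_powRN; rewrite subr_gt0.
Unshelve. all: by end_near. Qed.

Lemma measurable_max_ratio n m :
  measurable_fun setT (fun P : dhomog n R m => vertex_max P / cube_max P).
Proof.
(* On nonnegative reals, 0 included, inversion agrees with the power -1, which is measurable. *)
rewrite (_ : (fun _ => _) = fun P : dhomog n R m => vertex_max P * cube_max P `^ (-1)).
  apply: measurable_funM; first exact: measurable_vertex_max.
  apply: (measurableT_comp (measurable_powR _)); exact: measurable_cube_max.
apply/funext => P; rewrite powR_inv1// (le_trans _ (vertex_max_le_cube_max P))//.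
exact: bigmax_ge_id.
Qed.

Lemma good_ratio n m (beta : R) (P : dhomog n R m) : good beta P ->
  0 <= 1 - vertex_max P / cube_max P <= n%:R `^ (- beta).
Proof.
move=> [M0 h]; have VM := vertex_max_le_cube_max P.
by rewrite subr_ge0 lerBlDl -lerBlDr ler_pdivrMr// mul1r VM ler_pdivlMr.
Qed.

End good_event.

Theorem corollary1 (R : realType) (m : nat) (m_ge1 : (1 <= m)%N) :
  (forall beta : R, 0 < beta < 1 / 2 ->
    bombieri_gaussian R n m [set P | (1 - n%:R `^ (- beta)) * cube_max P <= vertex_max P]
      @[n --> \oo] --> 1%E) /\
  (forall (d : nat -> measure_display) (T : forall n, measurableType (d n))
      (Pr : forall n, probability (T n) R)
      (P : forall n, {RV (Pr n) >-> dhomog n R m}),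
    (forall n (A : set (dhomog n R m)), measurable A ->
      distribution (Pr n) (P n) A = bombieri_gaussian R n m A) ->
    (forall beta : R, 0 < beta < 1 / 2 ->
      cvg_in_probability Pr
        (fun n w => n%:R `^ beta * (1 - vertex_max (P n w) / cube_max (P n w)))
        0) /\
    cvg_in_probability Pr
      (fun n w => vertex_max (P n w) / cube_max (P n w)) 1).
Proof.
split=> [beta betaP|d T Pr P lawP].
  pose A n : set (dhomog n R m) :=
    [set P | (1 - n%:R `^ (- beta)) * cube_max P <= vertex_max P].
  have mA n : measurable (A n) by exact: measurable_vertex_ratio.
  have cA : bombieri_gaussian R n m (~` A n) @[n --> \oo] --> 0%E.
    apply: (cvg_bad m_ge1 betaP) => [n|]; first by apply: measurableC; exact: mA.
    by apply: nearW => n P nA [_ /nA].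
  have E n : bombieri_gaussian R n m (A n) =
      (1 - bombieri_gaussian R n m (~` A n))%E.
    rewrite -[in LHS](setCK (A n)) probability_setC//.
    by apply: measurableC; exact: mA.
  have : (1 - bombieri_gaussian R n m (~` A n))%E @[n --> \oo] --> (1 - 0)%E.
    by apply: cvgeB => //; exact: cvg_cst.
  by rewrite sube0 (eq_cvg _ _ E).
(* A deterministic estimate on [good] yields convergence in probability; only the law of [P n]
   matters. *)
have transfer (f : forall n, dhomog n R m -> R) (l beta : R) : 0 < beta < 1 / 2 ->
    (forall n, measurable_fun setT (f n)) ->
    (forall eps : R, 0 < eps -> \forall n \near \oo, forall Q : dhomog n R m,
      good beta Q -> `|f n Q - l| <= eps) ->
    cvg_in_probability Pr (fun n w => f n (P n w)) l.
  move=> betaP mf fl eps eps0.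
  pose A n : set (dhomog n R m) := [set Q | eps < `|f n Q - l|].
  have mA n : measurable (A n).
    rewrite -[A n]setTI (_ : _ `&` _ = ~` [set Q | `|f n Q - l| <= eps]).
      apply: measurableC; rewrite -[X in measurable X]setTI.
      apply: measurable_fun_le => //; apply: measurableT_comp => //.
      by apply: measurable_funB; [exact: mf|exact: measurable_cst].
    rewrite setTI; apply/seteqP; split => Q; rewrite /A /=.
      by rewrite ltNge => /negP.
    by move=> /negP; rewrite -ltNge.
  rewrite (eq_cvg _ _ (fun n => lawP n (A n) (mA n))).
  apply: (cvg_bad m_ge1 betaP) => //.
  have := fl eps eps0; apply: filterS => n h Q /= AQ gQ.
  by have := h Q gQ; rewrite leNgt AQ.
split=> [beta /andP[b0 b2]|].
  (* A larger exponent, still below 1/2, leaves the factor [n ^ (beta - beta')], which tends to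
     0. *)
  pose beta' := (beta + 1 / 2) / 2.
  apply: (transfer
    (fun n Q => n%:R `^ beta * (1 - vertex_max Q / cube_max Q)) _ beta').
  - by apply/andP; split; rewrite /beta'; lra.
  - move=> n; apply: measurable_funM => //; apply: measurable_funB => //.
    exact: measurable_max_ratio.
  - move=> eps eps0; have g0 : 0 < beta' - beta by rewrite /beta'; lra.
    near=> n => Q gQ; have /andP[r0 r1] := good_ratio gQ.
    have n0 : 0 < n%:R :> R by rewrite ltr0n; near: n; exact: nbhs_infty_gt.
    rewrite subr0 ger0_norm ?mulr_ge0 ?powR_ge0//.
    rewrite (le_trans (ler_wpM2l (powR_ge0 _ _) r1))//.
    rewrite -powRD; last by apply/implyP => _; rewrite gt_eqF.
    by rewrite -opprB; near: n; exact: near_powRN.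
(* Any exponent strictly between 0 and 1/2 would serve. *)
apply: (transfer (fun n Q => vertex_max Q / cube_max Q) _ (1 / 4)).
- by apply/andP; split; lra.
- by move=> n; exact: measurable_max_ratio.
- move=> eps eps0; near=> n => Q gQ; have /andP[r0 r1] := good_ratio gQ.
  rewrite distrC ger0_norm// (le_trans r1)//.
  by near: n; apply: near_powRN => //; lra.
Unshelve. all: by end_near. Qed.
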